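(* Let $L$ be a distributive lattice, $d$ a derivation on $L$, and $I$ an ideal of $L$ with $I\neq L$. Then $L/\theta_I^d$ is a Boolean algebra if and only if for each $x\in L$ there exists $y\in (x)_I^d$ such that $x\vee y\in \mathcal{K}_I^d$.
   Context: $L$ is not assumed bounded. An ideal of $L$ is a nonempty subset $I$ closed under $\vee$ such that $a\wedge x\in I$ whenever $a\in I$, $x\in L$. A derivation on $L$ is a map $d:L\to L$ with $d(x\wedge y)=(d(x)\wedge y)\vee(x\wedge d(y))$ and $d(x\vee y)=d(x)\vee d(y)$ for all $x,y$. Define $\ker_I d=\{x\in L\mid d(x)\in I\}$, $(a)_I^d=\{x\in L\mid d(a\wedge x)\in I\}$ for $a\in L$, and $\mathcal{K}_I^d=\{a\in L\mid (a)_I^d=\ker_I d\}$. The relation $\theta_I^d$ is defined by $x\,\theta_I^d\,y$ iff $(x)_I^d=(y)_I^d$; it is a lattice congruence on $L$, and $L/\theta_I^d$ is the quotient lattice. A Boolean algebra is a bounded, complemented distributive lattice (the one-element lattice is allowed). *)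

(* Defs.v *)
From HB Require Import structures.
From mathcomp Require Import all_boot all_order.
From mathcomp Require Import boolp classical_sets.

Set Implicit Arguments.
Unset Strict Implicit.
Unset Printing Implicit Defensive.

Import Order.Theory.
Local Open Scope order_scope.
Local Open Scope quotient_scope.

(* A predicate on bare lattices: distributivity is part of it, and bottom = top
   is allowed. *)
Definition boolean_algebra disp (B : latticeType disp) : Prop :=
  [/\ @left_distributive B B Order.meet Order.join
    & exists bot top : B,
        (forall x, bot <= x <= top) /\
        (forall x, exists y, x `&` y = bot /\ x `|` y = top)].

Record lattice_congruence disp (L : latticeType disp) := LatticeCongruence {
  congr_rel :> equiv_rel L;
  congr_meet : forall x x' y y',
    congr_rel x x' -> congr_rel y y' -> congr_rel (x `&` y) (x' `&` y');
  congr_join : forall x x' y y',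
    congr_rel x x' -> congr_rel y y' -> congr_rel (x `|` y) (x' `|` y') }.

Section QuotientLattice.
Context {disp : Order.disp_t} {L : latticeType disp}.
Variable C : lattice_congruence L.

Definition lattice_quot : Type := {eq_quot C}.
HB.instance Definition _ := Choice.on lattice_quot.
HB.instance Definition _ := EqQuotient.on lattice_quot.

Definition quot_meet := lift_op2 lattice_quot (@Order.meet disp L).
Definition quot_join := lift_op2 lattice_quot (@Order.join disp L).

Lemma pi_meet : {morph \pi_lattice_quot : x y / x `&` y >-> quot_meet x y}.
Proof.
by move=> x y; unlock quot_meet; apply/eqmodP/congr_meet; apply/eqmodP;
  rewrite reprK.
Qed.

Lemma pi_join : {morph \pi_lattice_quot : x y / x `|` y >-> quot_join x y}.
Proof.
by move=> x y; unlock quot_join; apply/eqmodP/congr_join; apply/eqmodP;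
  rewrite reprK.
Qed.

Lemma quot_meetC : commutative quot_meet.
Proof. by elim/quotW=> x; elim/quotW=> y; rewrite -!pi_meet meetC. Qed.

Lemma quot_joinC : commutative quot_join.
Proof. by elim/quotW=> x; elim/quotW=> y; rewrite -!pi_join joinC. Qed.

Lemma quot_meetA : associative quot_meet.
Proof.
by elim/quotW=> x; elim/quotW=> y; elim/quotW=> z; rewrite -!pi_meet meetA.
Qed.

Lemma quot_joinA : associative quot_join.
Proof.
by elim/quotW=> x; elim/quotW=> y; elim/quotW=> z; rewrite -!pi_join joinA.
Qed.

Lemma quot_joinKI y x : quot_meet x (quot_join x y) = x.
Proof.
by elim/quotW: x => x; elim/quotW: y => y; rewrite -pi_join -pi_meet joinKI.
Qed.

Lemma quot_meetKU y x : quot_join x (quot_meet x y) = x.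
Proof.
by elim/quotW: x => x; elim/quotW: y => y; rewrite -pi_meet -pi_join meetKU.
Qed.

Definition quot_le (x y : lattice_quot) := quot_meet x y == x.

Lemma quot_le_refl : reflexive quot_le.
Proof. by elim/quotW=> x; rewrite /quot_le -pi_meet meetxx. Qed.

Lemma quot_le_anti : antisymmetric quot_le.
Proof. by move=> x y /andP[/eqP xy /eqP yx]; rewrite -[LHS]xy quot_meetC. Qed.

Lemma quot_le_trans : transitive quot_le.
Proof.
by move=> y x z /eqP xy /eqP yz; apply/eqP; rewrite -xy -quot_meetA yz.
Qed.

HB.instance Definition _ := Order.Le_isPOrder.Build disp lattice_quot
  quot_le_refl quot_le_anti quot_le_trans.

HB.instance Definition _ := Order.POrder_isLattice.Build disp lattice_quot
  quot_meetC quot_joinC quot_meetA quot_joinA quot_joinKI quot_meetKU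
  (fun _ _ => erefl).

Lemma pi_quotI : {morph \pi_lattice_quot : x y / x `&` y >-> x `&` y}.
Proof. exact: pi_meet. Qed.

Lemma pi_quotU : {morph \pi_lattice_quot : x y / x `|` y >-> x `|` y}.
Proof. exact: pi_join. Qed.

Lemma pi_quotP x y :
  reflect (\pi_lattice_quot x = \pi_lattice_quot y) (congr_rel C x y).
Proof. exact: eqmodP. Qed.

End QuotientLattice.

Record derivation disp (L : latticeType disp) := Derivation {
  deriv :> L -> L;
  derivI : forall x y, deriv (x `&` y) = (deriv x `&` y) `|` (x `&` deriv y);
  derivU : forall x y, deriv (x `|` y) = deriv x `|` deriv y }.

Record ideal disp (L : latticeType disp) := Ideal {
  ideal_set :> set L;
  ideal_neq0 : (ideal_set !=set0)%classic;
  idealU : forall a b, ideal_set a -> ideal_set b -> ideal_set (a `|` b);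
  idealI : forall a x, ideal_set a -> ideal_set (a `&` x) }.

Section DerivationCongruence.
Context {disp : Order.disp_t} {L : distrLatticeType disp}.
Variables (I : ideal L) (d : derivation L).

Definition deriv_ker : set L := [set x | ideal_set I (d x)]%classic.

Definition deriv_ann (a : L) : set L := [set x | ideal_set I (d (a `&` x)%O)]%classic.

(* The calligraphic K of I and d: the elements whose annihilator is the
   kernel, the least possible one. *)
Definition deriv_K : set L := [set a | deriv_ann a = deriv_ker]%classic.

Definition theta : rel L := fun x y => `[< deriv_ann x = deriv_ann y >].

Lemma theta_refl : reflexive theta.
Proof. by move=> x; apply/asboolP. Qed.

Lemma theta_sym : symmetric theta.
Proof. by move=> x y; apply/asboolP/asboolP. Qed.

Lemma theta_trans : transitive theta.
Proof. by move=> y x z /asboolP xy /asboolP yz; apply/asboolP; rewrite xy. Qed.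

Canonical theta_equiv := EquivRel theta theta_refl theta_sym theta_trans.

Lemma deriv_annI x y z : deriv_ann (x `&` y) z = deriv_ann x (y `&` z).
Proof. by rewrite /deriv_ann /= meetA. Qed.

Lemma deriv_annU x y :
  deriv_ann (x `|` y) = (deriv_ann x `&` deriv_ann y)%classic.
Proof.
apply/seteqP; split=> z; rewrite /deriv_ann /= meetUl derivU; last first.
  by case; apply: idealU.
move=> Ixy; split.
  by rewrite -[d _](joinKI (d (y `&` z))) meetC; apply: idealI.
by rewrite -[d _](joinKI (d (x `&` z))) meetC joinC; apply: idealI.
Qed.

Lemma theta_meet x x' y y' :
  theta x x' -> theta y y' -> theta (x `&` y) (x' `&` y').
Proof.
move=> /asboolP xx' /asboolP yy'; apply/asboolP.
apply/funext => z; rewrite deriv_annI xx' -deriv_annI meetC deriv_annI yy'.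
by rewrite -deriv_annI meetC.
Qed.

Lemma theta_join x x' y y' :
  theta x x' -> theta y y' -> theta (x `|` y) (x' `|` y').
Proof.
by move=> /asboolP xx' /asboolP yy'; apply/asboolP; rewrite !deriv_annU xx' yy'.
Qed.

Definition theta_congruence : lattice_congruence L :=
  @LatticeCongruence _ L theta_equiv theta_meet theta_join.

End DerivationCongruence.

(* Main.v *)
(** In the quotient, the class of [a] is the least element iff [a] lies in the
    kernel, and the greatest element iff [a] lies in [deriv_K]. The condition
    on [y] thus says exactly that the class of [y] is a complement of that of
    [x]. *)

Require Import Defs.
From mathcomp Require Import all_boot all_order.
From mathcomp Require Import boolp classical_sets.

Import Order.Theory.
Local Open Scope order_scope.
Local Open Scope quotient_scope.

Lemma ideal_le (disp : Order.disp_t) (L : latticeType disp) (I : ideal L)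
    (a b : L) : a <= b -> ideal_set I b -> ideal_set I a.
Proof. by move=> /meet_idPr <-; apply: idealI. Qed.

Section Derivation.
Context {disp : Order.disp_t} {L : latticeType disp}.
Variable d : derivation L.

(** Expand [d] at [x = x /\ x]: both terms of the product rule lie below [x]. *)
Lemma deriv_le (x : L) : d x <= x.
Proof. by rewrite -{1}(meetxx x) derivI leUx leIr leIl. Qed.

Lemma deriv_homo (x y : L) : x <= y -> d x <= d y.
Proof. by move=> /join_idPl <-; rewrite derivU leUr. Qed.

End Derivation.

Section LatticeQuotient.
Context {disp : Order.disp_t} {L : latticeType disp}.
Variable C : lattice_congruence L.
Let Q := lattice_quot C.

(** Turns an inequality of classes into a congruence, which for [theta] is an equality of
    annihilators. *)
Lemma pi_quot_le (x y : L) : (\pi_Q x <= \pi_Q y) = C (x `&` y) x.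
Proof. by rewrite leEmeet -pi_quotI; apply/eqP/idP => /pi_quotP. Qed.

End LatticeQuotient.

Lemma lattice_quot_distr (disp : Order.disp_t) (L : distrLatticeType disp)
    (C : lattice_congruence L) :
  @left_distributive (lattice_quot C) (lattice_quot C) Order.meet Order.join.
Proof.
elim/quotW=> x; elim/quotW=> y; elim/quotW=> z.
by rewrite -!(pi_quotI, pi_quotU) meetUl.
Qed.

Section DerivationQuotient.
Context {disp : Order.disp_t} {L : distrLatticeType disp}.
Variables (d : derivation L) (I : ideal L).
Let Q := lattice_quot (theta_congruence I d).

Lemma deriv_ker_le (a b : L) : a <= b -> deriv_ker I d b -> deriv_ker I d a.
Proof. by move=> /(deriv_homo d); apply: ideal_le. Qed.

Lemma ideal_deriv_ker (a : L) : ideal_set I a -> deriv_ker I d a.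
Proof. exact: ideal_le (deriv_le d a). Qed.

Lemma deriv_ann_ker (a : L) : deriv_ker I d a -> deriv_ann I d a = setT.
Proof.
by move=> ka; apply/seteqP; split=> // z _; apply: deriv_ker_le (leIl a z) ka.
Qed.

Lemma deriv_ker_botP (a : L) :
  deriv_ker I d a <-> forall u : Q, \pi_Q a <= u.
Proof.
split=> [ka | bot_a].
  elim/quotW=> z; rewrite pi_quot_le; apply/asboolP.
  by rewrite !deriv_ann_ker //; apply: deriv_ker_le (leIl a z) ka.
(* [L] may lack a bottom, so compare [a] with some [i] in [I]: [a] annihilates [a /\ i], hence lies
   in its own annihilator, and [d (a /\ a)] is in [I]. *)
have [i Ii] := ideal_neq0 I.
have := bot_a (\pi_Q i); rewrite pi_quot_le => /asboolP ann_a.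
have : deriv_ann I d a a.
  rewrite -ann_a; apply: deriv_ker_le (ideal_deriv_ker _ Ii).
  by rewrite -meetA leIxr ?leIl.
by apply: deriv_ker_le; rewrite meetxx.
Qed.

Lemma deriv_K_topP (a : L) :
  deriv_K I d a <-> forall u : Q, u <= \pi_Q a.
Proof.
split=> [Ka | top_a].
  (* [w] annihilates [a /\ z] iff [z /\ w] annihilates [a], that is, iff [z /\ w] is in the
     kernel. *)
  elim/quotW=> z; rewrite pi_quot_le; apply/asboolP/funext => w.
  by rewrite meetC deriv_annI Ka.
apply/seteqP; split=> z; last by apply: deriv_ker_le; exact: leIr.
(* If [z] annihilates [a], it annihilates [z /\ a], which has the same annihilator as [z]; so [z] is
   in the kernel. *)
have := top_a (\pi_Q z); rewrite pi_quot_le => /asboolP ann_z az.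
have : deriv_ann I d z z.
  by rewrite -ann_z; apply: deriv_ker_le az; rewrite meetAC meetxx meetC.
by apply: deriv_ker_le; rewrite meetxx.
Qed.

End DerivationQuotient.

Theorem theorem4p2 (disp : Order.disp_t) (L : distrLatticeType disp)
    (d : derivation L) (I : ideal L) (I_proper : (I : set L) <> setT) :
  boolean_algebra (lattice_quot (theta_congruence I d)) <->
  (forall x : L, exists y : L,
     deriv_ann I d x y /\ deriv_K I d (x `|` y)).
Proof.
set Q := lattice_quot _; split=> [[_ [bot [top [bnd compl]]]] x | compl].
  have [v] := compl (\pi_Q x); elim/quotW: v => y [xy_bot xy_top].
  exists y; split.
    apply/deriv_ker_botP => u; rewrite pi_quotI xy_bot.
    by have /andP[] := bnd u.
  by apply/deriv_K_topP => u; rewrite pi_quotU xy_top; have /andP[] := bnd u.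
split; first exact: lattice_quot_distr.
(* The bounds come from one element of [I]: its class is least, and the condition applied to it
   yields an element of [deriv_K], whose class is greatest. *)
have [i Ii] := ideal_neq0 I.
have [j [_ /deriv_K_topP top_k]] := compl i.
have /deriv_ker_botP bot_i := @ideal_deriv_ker _ _ d I i Ii.
exists (\pi_Q i), (\pi_Q (i `|` j)); split=> [u|].
  by rewrite bot_i top_k.
elim/quotW=> x; have [y [/deriv_ker_botP bot_xy /deriv_K_topP top_xy]] := compl x.
exists (\pi_Q y); rewrite -pi_quotI -pi_quotU.
(* Least elements coincide, and so do greatest ones. *)
by split; apply/eqP; rewrite eq_le ?(bot_xy, bot_i) ?(top_xy, top_k).
Qed.
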